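(* Let $N$ be an even positive integer such that $N-1$ is an odd prime power, let $q$ be an even (positive) divisor of $N-2$, let $x$ be a primitive element of $\mathrm{GF}(N-1)$, and let $T$ be a subset of $\mathbb{Z}_q$ of size $q/2$. For $r\in\{0,\ldots,q-1\}$ and $a\in \mathrm{GF}(N-1)$ put $$S_{r,a}=\{x^{jq+i}+a : 0\le j\le (N-2)/q-1,\ i\in T+r\}.$$ Then the $q(N-1)$ sets $\{S_{r,a}: r=0,\ldots,q-1,\ a\in\mathrm{GF}(N-1)\}$ (counted with multiplicity, one for each pair $(r,a)$) form the blocks of a $\mathrm{BIBD}(N-1,\,q(N-1),\,N/2-1)$ with treatment set $\mathrm{GF}(N-1)$. Furthermore, if $(N-2)/q$ is odd and $U$ is a subset of $\mathbb{Z}_q$ of size $q/2$ such that $U^*=U+(q/2)$, where $U^*$ is the complement of $U$ in $\mathbb{Z}_q$, then the $q(N-1)/2$ sets $\{S_{r,a}: r\in U,\ a\in\mathrm{GF}(N-1)\}$ (again counted with multiplicity) form the blocks of a $\mathrm{BIBD}(N-1,\,q(N-1)/2,\,N/2-1)$.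
   Context: $\mathrm{GF}(s)$ denotes a finite field with $s$ elements; a primitive element is a generator of its cyclic multiplicative group of nonzero elements. For a positive integer $q$, $\mathbb{Z}_q=\{0,1,\ldots,q-1\}$ with addition and multiplication reduced modulo $q$. For $T=\{a_1,\ldots,a_t\}\subseteq\mathbb{Z}_q$ and $b\in\mathbb{Z}_q$, $T+b=\{a_1+b,\ldots,a_t+b\}$, with elements reduced modulo $q$ to lie in $\{0,\ldots,q-1\}$. A $\mathrm{BIBD}(v,b,k)$ (balanced incomplete block design) is a family of $b$ blocks, each a $k$-element subset of a set of $v$ treatments (repeated blocks are allowed), such that every treatment lies in the same number of blocks and every pair of distinct treatments is contained in the same number of blocks. *)

(* Defs.v *)
From HB Require Import structures.
From mathcomp Require Import all_boot all_order all_algebra all_fingroup all_solvable.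

Set Implicit Arguments.
Unset Strict Implicit.
Unset Printing Implicit Defensive.

Import GRing.Theory.
Local Open Scope ring_scope.

Definition prime_power (n : nat) : Prop :=
  exists p e : nat, [/\ prime p, (0 < e)%N & n = (p ^ e)%N].

(* The blocks are a family indexed by I, so that repeated blocks are counted
   with multiplicity; the treatments are all the elements of V. *)
Definition BIBD (I V : finType) (B : I -> {set V}) (v b k : nat) : Prop :=
  [/\ #|V| = v,
      #|I| = b,
      forall i : I, #|B i| = k,
      exists r : nat, forall y : V, #|[set i : I | y \in B i]| = r
    & exists lambda : nat, forall y z : V, y != z ->
        #|[set i : I | (y \in B i) && (z \in B i)]| = lambda].

(* 'Z_q is the ring of integers modulo q only for q > 1; all the uses below are
   for q even and positive. *)
Definition shift (q : nat) (T : {set 'Z_q}) (b : 'Z_q) : {set 'Z_q} :=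
  [set t + b | t in T].

Definition Sblock (F : finFieldType) (N q : nat) (x : F) (T : {set 'Z_q})
    (r : 'Z_q) (a : F) : {set F} :=
  [set x ^+ (j * q + i)%N + a | j : 'I_((N - 2) %/ q), i : 'Z_q in shift T r].

(* Main.v *)
Require Import Defs.
From HB Require Import structures.
From mathcomp Require Import all_boot all_order all_algebra all_fingroup all_solvable.

Set Implicit Arguments.
Unset Strict Implicit.
Unset Printing Implicit Defensive.

Import GRing.Theory.
Local Open Scope ring_scope.

(** Since [q] divides the order [N - 2] of the unit group, the exponent of a
    nonzero [c] as a power of [x] is well defined modulo [q]; call it the
    cyclotomic class of [c], a morphism from the units to the integers modulo
    [q] ([cyc_classM]).  Then [S r a] consists of the [y != a] for which the
    class of [y - a] lies in [T + r] ([mem_Sblock]).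

    Block sizes and replication numbers are immediate, because for fixed [r]
    the blocks are the translates of one set.  For the balance, let
    [concurrence r y z] be the number of [a] such that [S r a] contains both
    [y] and [z].  An affine map [u |-> d * u + b] permutes the translations and
    shifts classes by that of [d], so [concurrence r y z] equals
    [concurrence (r - class of (z - y)) 0 1] ([concurrence01]).  Hence a pair
    [y, z] matters only through a shift of [r], and a family of indices [r]
    yields a BIBD as soon as the sum of [g r := concurrence r 0 1] over the
    shifted family does not depend on the shift ([Sblock_BIBD]).

    When [r] runs over all residues this is obvious.  For the half family,
    swap the two treatments: [g r = concurrence r 1 0 = g (r - class of -1)].
    If [(N - 2) / q] is odd, then [-1 = x ^ ((N - 2) / 2)] has class [q / 2], so
    [g] has period [q / 2].  As [U] and [U + q / 2] partition the residues, so
    do their shifts, and [g] has the same sum over any shift of [U] as over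
    the complementary shift, namely half of its total ([sum_half_period]). *)

Lemma card_dep_pairs (I J : finType) (P : I -> pred J) :
  #|[set ij : I * J | P ij.1 ij.2]| = (\sum_i #|[set j | P i j]|)%N.
Proof.
rewrite -sum1dep_card -(pair_big_dep predT P (fun _ _ => 1%N)) /=.
by apply: eq_bigr => i _; rewrite sum1dep_card.
Qed.

Lemma natr_Zq_eqmod (q m n : nat) :
  (1 < q)%N -> m = n %[mod q] -> m%:R = n%:R :> 'Z_q.
Proof.
by move=> q_gt1 eq_mn; rewrite -(Zp_nat_mod q_gt1 m) eq_mn Zp_nat_mod.
Qed.

Lemma mem_shift (q : nat) (A : {set 'Z_q}) b i : (i \in shift A b) = (i - b \in A).
Proof.
apply/imsetP/idP=> [[t tA ->] | ibA]; first by rewrite addrK.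
by exists (i - b); rewrite ?subrK.
Qed.

Lemma card_shift (q : nat) (A : {set 'Z_q}) b : #|shift A b| = #|A|.
Proof. by rewrite card_imset //; apply: addIr. Qed.

Lemma ltn_Zq (q : nat) (i : 'Z_q) : (1 < q)%N -> (i < q)%N.
Proof. by move=> q_gt1; rewrite -[X in (_ < X)%N](Zp_cast q_gt1). Qed.

Section CyclotomicBlocks.

Variables (F : finFieldType) (x : {unit F}) (N q : nat).
Hypotheses (cardF : #|F| = (N - 1)%N) (x_prim : generator [set: {unit F}] x).
Hypotheses (q_gt1 : (1 < q)%N) (q_dvd : (q %| N - 2)%N).

Let e := ((N - 2) %/ q)%N.

Lemma units_order : #[x]%g = (N - 2)%N.
Proof.
have /eqP defG := x_prim.
by rewrite orderE -defG card_finField_unit cardF -subn1 -subnDA.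
Qed.

Lemma units_order_gt0 : (0 < N - 2)%N.
Proof. by rewrite -units_order order_gt0. Qed.

Lemma primitive_pow_eq m n :
  (val x ^+ m == val x ^+ n) = (m == n %[mod N - 2]).
Proof.
by rewrite -units_order -eq_expg_mod_order -!FinRing.val_unitX (inj_eq val_inj).
Qed.

Lemma primitive_powP c : c != 0 -> exists n, c = val x ^+ n.
Proof.
rewrite -unitfE => Uc; have /eqP defG := x_prim.
have: FinRing.unit F Uc \in <[x]>%g by rewrite -defG inE.
by case/cycleP=> n /(congr1 val); rewrite FinRing.val_unitX => /= ->; exists n.
Qed.

Lemma primitive_pow_neq0 n : val x ^+ n != 0.
Proof. by rewrite expf_neq0 // -unitfE (valP x). Qed.

(** The exponent of [c] to the base [x], reduced modulo [q]; the value at [0]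
    is junk. *)
Definition cyc_class (c : F) : 'Z_q :=
  (find (fun n => val x ^+ n == c) (iota 0 (N - 2)))%:R.

(** [find] returns some exponent congruent to [n] modulo [N - 2], hence modulo
    its divisor [q]. *)
Lemma cyc_classX n : cyc_class (val x ^+ n) = n%:R.
Proof.
rewrite /cyc_class; set P := fun _ => _; set s := iota _ _.
have hasP : has P s.
  apply/hasP; exists (n %% (N - 2))%N; first by rewrite mem_iota ltn_mod units_order_gt0.
  by rewrite /P primitive_pow_eq modn_mod.
have := nth_find 0%N hasP; rewrite nth_iota; last first.
  by move: hasP; rewrite has_find size_iota.
rewrite add0n /P primitive_pow_eq => /eqP eq_n.
apply: natr_Zq_eqmod => //.
by rewrite -(modn_dvdm (find P s) q_dvd) [X in (X %% q)%N]eq_n modn_dvdm.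
Qed.

Lemma cyc_classM c d :
  c != 0 -> d != 0 -> cyc_class (c * d) = cyc_class c + cyc_class d.
Proof.
move=> /primitive_powP[m ->] /primitive_powP[n ->].
by rewrite -exprD !cyc_classX natrD.
Qed.

(** With [q = 2h] one has [N - 2 = 2he], so [x ^ (he)] is a square root of [1]
    other than [1], that is [-1]; and [he] is [h] modulo [2h] as [e] is odd. *)
Lemma cyc_classN1 : odd e -> ~~ odd q -> cyc_class (-1) = (q %/ 2)%:R.
Proof.
move=> odd_e even_q; set h := (q %/ 2)%N.
have def_q : q = h.*2 by rewrite -muln2 divnK // dvdn2.
have def_N : (N - 2 = (h * e).*2)%N.
  by rewrite -(divnK q_dvd) -/e [in LHS]def_q -doubleMr mulnC.
have he_gt0 : (0 < h * e)%N by have := units_order_gt0; rewrite def_N double_gt0.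
have: (val x ^+ (h * e)) ^+ 2 == 1.
  by rewrite -exprM muln2 -def_N -(expr0 (val x)) primitive_pow_eq modnn mod0n.
rewrite sqrf_eq1 -(expr0 (val x)) primitive_pow_eq mod0n modn_small; last first.
  by rewrite def_N -addnn -{1}[(h * e)%N]addn0 ltn_add2l.
rewrite eqn0Ngt he_gt0 /= => /eqP; rewrite expr0 => <-.
rewrite cyc_classX; apply: natr_Zq_eqmod => //.
suff ->: (h * e = e./2 * q + h)%N by rewrite modnMDl.
by rewrite -{1}(odd_double_half e) odd_e def_q mulnDr muln1 addnC -!doubleMr mulnC.
Qed.

Variable T : {set 'Z_q}.
Local Notation S := (Sblock N (val x) T).

Lemma mem_Sblock r a y :
  (y \in S r a) = (y != a) && (cyc_class (y - a) - r \in T).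
Proof.
apply/imset2P/andP=> [[j i _] | [neq_ya]].
  rewrite mem_shift => iT ->; rewrite addrK cyc_classX natrD natrM.
  rewrite pchar_Zp // mulr0 add0r natr_Zp iT; split=> //.
  by rewrite -subr_eq0 addrK primitive_pow_neq0.
rewrite -subr_eq0 in neq_ya.
have [n0 def_y] := primitive_powP neq_ya.
have [n lt_n def_yn] : exists2 n, (n < N - 2)%N & y - a = val x ^+ n.
  exists (n0 %% (N - 2))%N; first by rewrite ltn_mod units_order_gt0.
  by apply/eqP; rewrite def_y primitive_pow_eq modn_mod.
rewrite def_yn cyc_classX => nT.
have lt_j : (n %/ q < e)%N by rewrite ltn_divLR ?divnK // ltnW.
exists (Ordinal lt_j) (n%:R); rewrite // ?inE ?mem_shift //=.
by rewrite val_Zp_nat // -divn_eq -def_yn subrK.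
Qed.

(** The exponents [j * q + i] are distinct and less than [N - 2], by uniqueness
    of Euclidean division by [q]. *)
Lemma card_Sblock r a : #|S r a| = (#|T| * e)%N.
Proof.
pose f (j : 'I_e) (i : 'Z_q) := val x ^+ (j * q + i)%N + a.
have ->: S r a = f @2: ([set: 'I_e], shift T r).
  by apply/setP=> y; apply/imset2P/imset2P=> -[j i _ iT ->]; exists j i; rewrite ?inE.
rewrite curry_imset2X card_in_imset => [|[j1 i1] [j2 i2] _ _ /=].
  by rewrite cardsX card_shift mulnC cardsE card_ord.
have lt_ji (j : 'I_e) (i : 'Z_q) : (j * q + i < N - 2)%N.
  rewrite -(divnK q_dvd) (@leq_trans (j.+1 * q)) //; last first.
    by rewrite leq_mul2r ltn_ord orbT.
  by rewrite mulSn addnC ltn_add2r ltn_Zq.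
move/addIr/eqP; rewrite primitive_pow_eq !modn_small // => /eqP eq_ji.
have q_gt0 : (0 < q)%N by apply: ltnW.
congr (_, _); apply: val_inj => /=.
  have := congr1 (fun n => n %/ q)%N eq_ji.
  by rewrite !divnMDl // !divn_small ?ltn_Zq // !addn0.
by have := congr1 (fun n => n %% q)%N eq_ji; rewrite !modnMDl !modn_small ?ltn_Zq.
Qed.

Definition concurrence r y z := #|[set a | (y \in S r a) && (z \in S r a)]|.

Lemma concurrenceC r y z : concurrence r y z = concurrence r z y.
Proof. by apply: eq_card => a; rewrite !inE andbC. Qed.

(** The map [u |-> d * u + b] sends [S (r - cyc_class d) a] onto
    [S r (d * a + b)], and it permutes the translations [a]. *)
Lemma concurrence_affine r d b y z : d != 0 ->
  concurrence r (d * y + b) (d * z + b) = concurrence (r - cyc_class d) y z.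
Proof.
move=> d_neq0; have f_inj : injective (fun a => d * a + b).
  by move=> a1 a2 /addIr /(mulfI d_neq0).
have memS u a :
    (d * u + b \in S r (d * a + b)) = (u \in S (r - cyc_class d) a).
  rewrite !mem_Sblock (inj_eq f_inj); case: eqVneq => //= neq_ua.
  rewrite opprD addrACA subrr addr0 -mulrBr cyc_classM ?subr_eq0 //.
  by rewrite opprB addrCA addrA.
rewrite /concurrence -(card_preimset _ f_inj).
by apply: eq_card => a; rewrite !inE !memS.
Qed.

Lemma concurrence01 r y z :
  y != z -> concurrence r y z = concurrence (r - cyc_class (z - y)) 0 1.
Proof.
move=> neq_yz; rewrite -(concurrence_affine r y) ?subr_eq0 1?eq_sym //.
by rewrite mulr0 add0r mulr1 subrK.
Qed.

(** Exchanging the treatments [0] and [1] replaces their difference [1], of class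
    [0], by [-1]. *)
Lemma concurrence01N r :
  concurrence r 0 1 = concurrence (r - cyc_class (-1)) 0 1.
Proof. by rewrite concurrenceC concurrence01 ?oner_eq0 // sub0r. Qed.

(** The [a] with [y] in [S r a] are the [y - s] for [s] in [S r 0]. *)
Lemma card_containing_Sblocks r y : #|[set a | y \in S r a]| = (#|T| * e)%N.
Proof.
have f_inj : injective (fun a => y - a) by move=> a b /addrI /oppr_inj.
rewrite -(card_Sblock r 0) -(card_preimset _ f_inj).
apply: eq_card => a; rewrite !inE !mem_Sblock subr0.
by rewrite -(subr_eq0 y) opprB addrCA subrr addr0.
Qed.

(** Serves both designs: [rho] is the identity for the full family and the
    inclusion of [U] for the half family. *)
Lemma Sblock_BIBD (I : finType) (rho : I -> 'Z_q) lambda :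
    (forall c, (\sum_i concurrence (rho i - c)%R 0%R 1%R)%N = lambda) ->
  BIBD (fun ra : I * F => S (rho ra.1) ra.2)
    (N - 1) (#|I| * (N - 1)) (#|T| * e).
Proof.
move=> sum_lambda; split=> //.
- by rewrite card_prod cardF.
- by move=> ra; apply: card_Sblock.
- exists (#|I| * (#|T| * e))%N => y.
  rewrite (card_dep_pairs (fun i a => y \in S (rho i) a)).
  under eq_bigr do rewrite card_containing_Sblocks.
  by rewrite sum_nat_const.
- exists lambda => y z neq_yz.
  rewrite (card_dep_pairs (fun i a => (y \in S (rho i) a) && (z \in S (rho i) a))).
  rewrite -(sum_lambda (cyc_class (z - y))).
  by apply: eq_bigr => i _; rewrite -concurrence01.
Qed.

End CyclotomicBlocks.

(** Periodicity makes the sums over the shifts of [U] and of its complement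
    equal, and together they make up the total. *)
Lemma sum_half_period (q : nat) (h : 'Z_q) (U : {set 'Z_q}) (g : 'Z_q -> nat) c :
    ~: U = shift U h -> (forall r, g r = g (r - h)) ->
  (\sum_(r in U) g (r - c)%R = (\sum_r g r)./2)%N.
Proof.
move=> defUC gh.
have sumUC : (\sum_(r in ~: U) g (r - c)%R = \sum_(r in U) g (r - c)%R)%N.
  rewrite defUC big_imset => [|r s _ _ /addIr //] /=.
  by apply: eq_bigr => r _; rewrite gh addrAC addrK.
rewrite [in RHS](reindex_inj (addIr (- c))) [in RHS](bigID (mem U)) /=.
under [X in (_ + X)%N]eq_bigl do rewrite -in_setC.
by rewrite sumUC addnn doubleK.
Qed.

Theorem theorem2p1 (N : nat) (N_gt0 : (0 < N)%N) (N_even : ~~ odd N)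
    (N1_odd : odd (N - 1)) (N1_pp : prime_power (N - 1))
    (q : nat) (q_gt0 : (0 < q)%N) (q_even : ~~ odd q) (q_dvd : (q %| N - 2)%N)
    (F : finFieldType) (cardF : #|F| = (N - 1)%N)
    (x : {unit F}) (x_prim : generator [set: {unit F}] x)
    (T : {set 'Z_q}) (cardT : #|T| = (q %/ 2)%N) :
  BIBD (fun ra : 'Z_q * F => Sblock N (val x) T ra.1 ra.2)
    (N - 1) (q * (N - 1)) (N %/ 2 - 1)
  /\
  (odd ((N - 2) %/ q) ->
   forall U : {set 'Z_q}, #|U| = (q %/ 2)%N ->
     ~: U = shift U (q %/ 2)%:R ->
     BIBD (fun ra : {r : 'Z_q | r \in U} * F => Sblock N (val x) T (val ra.1) ra.2)
       (N - 1) (q * (N - 1) %/ 2) (N %/ 2 - 1)).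
Proof.
have q_gt1 : (1 < q)%N by case: q q_gt0 q_even {q_dvd T cardT} => [|[]].
have dvd2q : (2 %| q)%N by rewrite dvdn2.
have block_size : (N %/ 2 - 1 = #|T| * ((N - 2) %/ q))%N.
  have def_N : N = (#|T| * ((N - 2) %/ q)).+1.*2.
    rewrite doubleS doubleMl cardT -muln2 divnK // mulnC divnK // -addn2 subnK //.
    by case: N N_gt0 N_even {cardF N1_odd N1_pp q_dvd} => [|[]].
  by rewrite {1}def_N divn2 doubleK subn1.
rewrite block_size; split=> [|odd_e U cardU defUC].
  have -> : (q * (N - 1) = #|'Z_q| * (N - 1))%N by rewrite card_ord Zp_cast.
  apply: (Sblock_BIBD (rho := id) cardF x_prim q_gt1 q_dvd
            (lambda := \sum_r concurrence x N T r 0%R 1%R)) => c.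
  by rewrite [RHS](reindex_inj (addIr (- c))).
have cardI : #|{: {r | r \in U}}| = (q %/ 2)%N by rewrite card_sig.
rewrite -divn_mulAC // -cardI.
pose g r := concurrence x N T r 0 1.
apply: (Sblock_BIBD (rho := val) cardF x_prim q_gt1 q_dvd
          (lambda := (\sum_r g r)./2)) => c.
rewrite -(big_sub (mem U) (fun r => g (r - c))) /=.
apply: (sum_half_period _ defUC) => r.
by rewrite /g (concurrence01N cardF x_prim q_gt1 q_dvd) (cyc_classN1 cardF).
Qed.
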